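(* For every $\delta\in(0,\frac12)$ and every $\mathbf F\in\mathbf H_{0,\mathrm{curl}}(\Omega)$, $$\bar\delta\,\nabla\times(\mathcal K_\delta\mathbf F)=\mathcal K_\delta(\nabla\times\mathbf F),\qquad\bar\delta:=1-\delta.$$
   Context: $\Omega\subset\mathbb R^3$ is a bounded open Lipschitz domain with connected boundary, $0\in\Omega$, star-shaped with respect to every point of an open neighborhood of $0$; $\chi>0$ is a fixed number such that $(1-\delta)\Omega+B(0,\delta\chi)\subset\subset\Omega$ for all $\delta\in(0,1)$. $\mathbf H_{0,\mathrm{curl}}(\Omega)=\{\mathbf v\in\mathbf L^2(\Omega):\nabla\times\mathbf v\in\mathbf L^2(\Omega),\ \mathbf v\times\mathbf n|_{\partial\Omega}=0\}$. $E_\Omega\mathbf F$ is the extension of $\mathbf F$ by zero to $\mathbb R^3$; $(S^\delta_{\mathbb R^3}\mathbf G)(\mathbf x):=\mathbf G(\mathbf x/\bar\delta)$; $\rho_\delta(\mathbf x)=\delta^{-3}\rho(\mathbf x/\delta)$ with $\rho(\mathbf x)=\eta\exp(-\frac1{1-|\mathbf x|^2})$ for $|\mathbf x|<1$ and $0$ otherwise, $\int_{\mathbb R^3}\rho=1$. The smoothing operator is $\mathcal K_\delta\mathbf F:=\rho_{\delta\chi}\star(S^\delta_{\mathbb R^3}E_\Omega\mathbf F)$ for $\mathbf F\in\mathbf L^1(\Omega)$. *)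

(* Defs.v *)
From HB Require Import structures.
From mathcomp Require Import all_boot all_order all_algebra.
From mathcomp Require Import all_classical all_reals all_analysis.

Set Implicit Arguments.
Unset Strict Implicit.
Unset Printing Implicit Defensive.
Import Order.TTheory GRing.Theory Num.Theory.
Import numFieldNormedType.Exports.
Local Open Scope classical_set_scope.
Local Open Scope ring_scope.

(* Points and vectors of R^3 are triples, so that the library provides both the
   topology and the product measure.  The library norm of this type is the sup
   norm; whenever the metric matters we use the Euclidean norm [enorm]. *)
Notation R3 R := (R * R * R)%type.

Section Euclidean.
Context {R : realType}.
Implicit Types (x y : R3 R) (A B : set (R3 R)).

Definition coordinate (i : 'I_3) x : R := [:: x.1.1; x.1.2; x.2]`_i.

Definition unit_vec (i : 'I_3) : R3 R :=
  ((i == 0)%:R, (i == 1)%:R, (i == 2)%:R).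

Definition dot x y : R := \sum_(i < 3) coordinate i x * coordinate i y.

Definition enorm x : R := Num.sqrt (dot x x).

Definition eball x (r : R) : set (R3 R) := [set y | enorm (y - x) < r].

Definition leb3 := ((@lebesgue_measure R \x @lebesgue_measure R)
                     \x @lebesgue_measure R)%E.

Definition boundary A : set (R3 R) := closure A `\` A°.

Definition compactly_contained A B := compact (closure A) /\ closure A `<=` B.

Definition minkowski_sum A B : set (R3 R) := [set x + y | x in A & y in B].

Definition star_shaped_at A (z : R3 R) :=
  forall x (t : R), A x -> 0 <= t <= 1 -> A ((1 - t) *: z + t *: x).

(* Near each boundary point, in a suitable orthonormal frame (u 0, u 1, u 2),
   the set is the strict epigraph of a Lipschitz function. *)
Definition lipschitz_boundary A :=
  forall a, boundary A a ->
  exists (r : R) (u : 'I_3 -> R3 R) (g : R * R -> R),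
    [/\ 0 < r,
        forall i j, dot (u i) (u j) = (i == j)%:R,
        lipschitz g
      & forall y, eball a r y ->
          A y <-> g (dot (y - a) (u 0), dot (y - a) (u 1)) < dot (y - a) (u 2)].

End Euclidean.

Section Calculus.
Context {R : realType}.
Implicit Types (f g phi : R3 R -> R) (F G Phi : R3 R -> R3 R).

Definition partial (i : 'I_3) f (x : R3 R) : R := 'D_(unit_vec i) f x.

Definition curl F (x : R3 R) : R3 R :=
  let d i j := partial i (coordinate j \o F) x in
  (d 1 2 - d 2 1, d 2 0 - d 0 2, d 0 1 - d 1 0).

Fixpoint of_class_C (k : nat) f : Prop :=
  if k is k'.+1 then
    [/\ continuous f,
        forall i x, derivable f x (unit_vec i)
      & forall i, of_class_C k' (partial i f)]
  else continuous f.

Definition test_function (A : set (R3 R)) phi :=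
  (forall k, of_class_C k phi) /\
  compactly_contained [set x | phi x != 0] A.

Definition test_field (A : set (R3 R)) Phi :=
  forall i, test_function A (coordinate i \o Phi).

End Calculus.

(* Elements of the spaces over A are represented by functions on the whole of
   R^3, of which only the values on A are relevant. *)
Section FunctionSpaces.
Context {R : realType}.
Variable A : set (R3 R).
Implicit Types (f g : R3 R -> R) (F G W : R3 R -> R3 R).

Definition L2 f :=
  measurable_fun A f /\ finite_norm leb3 2%:E (patch (fun=> 0) A f).

Definition L2_field F := forall i, L2 (coordinate i \o F).

Definition weak_partial (i : 'I_3) f g :=
  forall phi, test_function A phi ->
    \int[leb3]_(x in A) (f x * partial i phi x) =
    - \int[leb3]_(x in A) (g x * phi x).

Definition H1 f := L2 f /\ forall i, exists2 g, L2 g & weak_partial i f g.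

Definition H1_field W := forall i, H1 (coordinate i \o W).

(* G is a representative of the distributional curl of F *)
Definition weak_curl F G :=
  forall Phi, test_field A Phi ->
    \int[leb3]_(x in A) dot (F x) (curl Phi x) =
    \int[leb3]_(x in A) dot (G x) (Phi x).

(* The tangential trace F x n is the functional on traces of H^1 fields given
   by Green's formula,
     < F x n, W > = \int_A F . curl W - \int_A curl F . W ;
   in the next definition G and C represent curl F and curl W. *)
Definition tangential_trace F G W C : R :=
  \int[leb3]_(x in A) dot (F x) (C x) - \int[leb3]_(x in A) dot (G x) (W x).

Definition zero_tangential_trace F :=
  forall G W C, L2_field G -> weak_curl F G ->
    H1_field W -> L2_field C -> weak_curl W C ->
    tangential_trace F G W C = 0.

Definition H0curl F :=
  [/\ L2_field F,
      exists2 G, L2_field G & weak_curl F G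
    & zero_tangential_trace F].

End FunctionSpaces.

Section Smoothing.
Context {R : realType}.
Implicit Types (F G : R3 R -> R3 R).

Definition bump (x : R3 R) : R :=
  if enorm x < 1 then expR (- (1 - enorm x ^+ 2)^-1) else 0.

(* the normalizing constant called eta, chosen so that rho has integral 1 *)
Definition bump_eta : R := (\int[leb3]_x bump x)^-1.

Definition rho (x : R3 R) : R := bump_eta * bump x.

Definition mollifier (e : R) (x : R3 R) : R := e ^- 3 * rho (e^-1 *: x).

Definition convolution (k : R3 R -> R) G (x : R3 R) : R3 R :=
  let c i := \int[leb3]_y (k (x - y) * coordinate i (G y)) in (c 0, c 1, c 2).

Definition zero_extension (A : set (R3 R)) F : R3 R -> R3 R :=
  patch (fun=> 0) A F.

Definition dilation (delta : R) G (x : R3 R) : R3 R := G ((1 - delta)^-1 *: x).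

Definition smoothing (A : set (R3 R)) (chi delta : R) F : R3 R -> R3 R :=
  convolution (mollifier (delta * chi)) (dilation delta (zero_extension A F)).

End Smoothing.

(* Main.v *)
Require Import Defs.
From HB Require Import structures.
From mathcomp Require Import all_boot all_order all_algebra.
From mathcomp Require Import all_classical all_reals all_analysis.
From mathcomp Require Import measurable_realfun ring lra.
Import Order.TTheory GRing.Theory Num.Theory.
Import numFieldNormedType.Exports.
Local Open Scope classical_set_scope.
Local Open Scope ring_scope.

(* Write c = 1 - delta and let k be the mollifier at scale delta * chi.  The
   substitution y = c z gives
     K F(x)_j = c^3 \int_Omega k(x - c z) F_j(z) dz,
   and k is C^1 with compact support, so one may differentiate under the
   integral.  For the smooth field W(z) = k(x - c z) e_l one finds
     F . curl W = c (d_i k(x - c z) F_j - d_j k(x - c z) F_i),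
   (l, i, j) cyclic, and the vanishing tangential trace of F tested against W,
     \int_Omega F . curl W = \int_Omega curl F . W,
   is the l-th component of the claim.  The weak derivatives of W are its
   classical ones: \int w(y) phi(t e_i + y) dy = \int w(y - t e_i) phi(y) dy by
   translation invariance, and both sides can be differentiated at t = 0. *)

(* leb3 lives on products of measurableTypeR R, whose measurable structure is
   convertible, but not syntactically equal, to the default one on R. *)
Notation M3 R := (measurableTypeR R * measurableTypeR R * measurableTypeR R)%type.

(** * Borel sets and affine maps in R^3 *)

Section BorelAffine.
Context {R : realType}.

(** Packages a rescaled pushforward as a measure, so that the uniqueness theorems for Lebesgue and
    product measures can be applied to it. *)
Lemma exists_scaled_image_measure d1 d2 (T1 : measurableType d1) (T2 : measurableType d2)
    (m : {measure set T1 -> \bar R}) (f : T1 -> T2) (k : R) :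
  0 <= k -> measurable_fun setT f ->
  exists m' : {measure set T2 -> \bar R}, forall A, m' A = (k%:E * m (f @^-1` A))%E.
Proof. by move=> k0 mf; unshelve eexists (mscale (NngNum k0) (pushforward m f)). Qed.

(** An open set is the countable union of the sup-norm balls inside it with rational centre and
    radius 1/(n+1); each such ball is a box, hence lies in the product sigma-algebra. *)
Lemma open_measurable_R3 (A : set (R3 R)) : open A -> measurable A.
Proof.
move=> oA.
pose q3 (q : rat * rat * rat) : R3 R := (ratr q.1.1, ratr q.1.2, ratr q.2).
pose F (i : rat * rat * rat * nat) : set (R3 R) :=
  if `[< ball (q3 i.1) (i.2.+1%:R^-1) `<=` A >] then
    ball (q3 i.1) (i.2.+1%:R^-1) else set0.
have -> : A = \bigcup_i F i.
  apply/seteqP; split => [x Ax|x [i _]]; last first.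
    by rewrite /F; case: asboolP => // + ?; apply.
  have /nbhs_ballP[e /= e0 xeA] : nbhs x A by exact: open_nbhs_nbhs.
  (* With radius below e/2, a ball around a rational centre that contains x stays within distance e
     of x. *)
  have e20 : 0 < e / 2 by rewrite divr_gt0.
  have [n _ /(_ n (leqnn n)) ne] := near_infty_natSinv_lt (PosNum e20).
  have r0 : 0 < n.+1%:R^-1 :> R by rewrite invr_gt0.
  have rq (y : R) : exists q : rat, `|ratr q - y| < n.+1%:R^-1.
    have /rat_in_itvoo[q] : y - n.+1%:R^-1 < y + n.+1%:R^-1.
      by rewrite ltrD2l gtrN.
    by rewrite in_itv/= -ltr_distl; exists q.
  have [q1 h1] := rq x.1.1.
  have [q2 h2] := rq x.1.2.
  have [q3' h3] := rq x.2.
  exists (q1, q2, q3', n) => //; rewrite /F.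
  case: asboolP => [_|]; first by split; [split|].
  case => y yb; apply: xeA.
  have xb : ball (q3 (q1, q2, q3')) n.+1%:R^-1 x by split; [split|].
  apply: (@le_ball _ _ x (n.+1%:R^-1 + n.+1%:R^-1)).
    by rewrite [leRHS]splitr ltW // ltrD.
  by apply: ball_triangle yb; exact: ball_sym.
apply: countable_bigcupT_measurable => // i; rewrite /F.
case: ifPn => // _.
rewrite (_ : ball _ _ = (ball (q3 i.1).1.1 (i.2.+1%:R^-1) `*` ball (q3 i.1).1.2 (i.2.+1%:R^-1))
  `*` ball (q3 i.1).2 (i.2.+1%:R^-1)) //.
by apply: measurableX; [apply: measurableX|]; apply: open_measurable; apply: ball_open;
 rewrite invr_gt0.
Qed.

Lemma continuous_measurable_R3 (f : R3 R -> R) :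
  continuous f -> measurable_fun setT f.
Proof.
move=> /continuousP cf; apply: (measurability _ (RGenOpens.measurableE R)).
move=> _ [_ [a [b ->] <-]]; rewrite setTI; apply: open_measurable_R3.
exact/cf/interval_open.
Qed.

(** Uniqueness of Lebesgue measure: c times the image measure has the right value on the intervals
    ]u, v]. *)
Lemma lebesgue_measure_affine (a c : R) (A : set R) : 0 < c -> measurable A ->
  (lebesgue_measure ((fun x => a + c * x)%R @^-1` A) = (c^-1)%:E * lebesgue_measure A)%E.
Proof.
move=> c0 mA.
have mT : measurable_fun setT (fun x : R => a + c * x).
  by apply: measurable_funD => //.
pose T : measurableTypeR R -> measurableTypeR R := fun x => a + c * x.
have mT' : measurable_fun setT T by exact: mT.
have [m mE] := exists_scaled_image_measure _ _ _ _ (@lebesgue_measure R) _ _ (ltW c0) mT'.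
have -> : lebesgue_measure A = m A.
  apply: lebesgue_measure_unique => //= _ [[u v]] _ <-.
  have E : T @^-1` `]u, v] = `](u - a) / c, (v - a) / c]%classic :> set R.
    apply/seteqP; split => x /=; rewrite !in_itv/=;
    by rewrite ltr_pdivrMr// ler_pdivlMr// ltrBlDl lerBrDl (mulrC x).
  rewrite mE lebesgue_measure_itv/= lte_fin.
  have -> : (lebesgue_measure (T @^-1` `]u, v]) =
      if ((u - a) / c < (v - a) / c)%R then ((v - a) / c - (u - a) / c)%:E else 0)%E.
    by rewrite E; exact: (lebesgue_measure_itv `](u - a) / c, (v - a) / c]).
  rewrite ltr_pM2r ?invr_gt0// ltrD2r.
  case: ifPn => _; last by rewrite mule0.
  by rewrite -!EFinD -EFinM; congr EFin; field; rewrite gt_eqF.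
by rewrite mE muleA -EFinM mulVf ?gt_eqF// mul1e.
Qed.
End BorelAffine.

(** After division by [k1 * k2] the image measure agrees with the product measure on measurable
    rectangles, which determine it. *)
Lemma product_measure_image d1 d2 (T1 : measurableType d1) (T2 : measurableType d2)
    (R : realType)
    (m1 : {sigma_finite_measure set T1 -> \bar R})
    (m2 : {sigma_finite_measure set T2 -> \bar R})
    (f1 : T1 -> T1) (f2 : T2 -> T2) (k1 k2 : R) :
  0 < k1 -> 0 < k2 -> measurable_fun setT f1 -> measurable_fun setT f2 ->
  (forall A, measurable A -> m1 (f1 @^-1` A) = (k1%:E * m1 A)%E) ->
  (forall A, measurable A -> m2 (f2 @^-1` A) = (k2%:E * m2 A)%E) ->
  forall A, measurable A ->
  ((m1 \x m2) ((fun x => (f1 x.1, f2 x.2)) @^-1` A) =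
     (k1 * k2)%:E * (m1 \x m2) A)%E.
Proof.
move=> k10 k20 mf1 mf2 h1 h2 A mA.
have k0 : 0 < k1 * k2 by rewrite mulr_gt0.
pose f (x : T1 * T2) := (f1 x.1, f2 x.2).
have mf : measurable_fun setT f.
  by apply: measurable_fun_pair; exact: measurableT_comp.
have kV0 : 0 <= (k1 * k2)^-1 by rewrite invr_ge0 ltW.
have [m mE] := @exists_scaled_image_measure R _ _ _ _ (m1 \x m2)%E f _ kV0 mf.
have -> : ((m1 \x m2) A = m A)%E.
  apply: product_measure_unique => // B C mB mC; rewrite mE.
  rewrite [X in (_ * X)%E = _](_ : _ = m1 (f1 @^-1` B) * m2 (f2 @^-1` C))%E; last first.
    apply: product_measure1E; last first.
    - by rewrite -[X in measurable X]setTI; exact: mf2.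
    - by rewrite -[X in measurable X]setTI; exact: mf1.
  rewrite h1// h2// muleACA -EFinM [LHS]muleA -EFinM mulVf ?mul1e//.
  by rewrite gt_eqF.
by rewrite mE muleA -EFinM divff ?mul1e// gt_eqF.
Qed.

(** The first factor of [leb3], named so that it can carry the sigma-finite structure required of a
    factor in [product_measure_image]. *)
Definition leb2 (R : realType) :=
  (@lebesgue_measure R \x @lebesgue_measure R)%E.
HB.instance Definition _ (R : realType) := Measure.on (leb2 R).

Lemma sigma_finite_leb2 (R : realType) : sigma_finite setT (leb2 R).
Proof.
exists (fun n => (`[- n%:R, n%:R]%classic `*` `[- n%:R, n%:R]%classic)).
  apply/seteqP; split => // x _.
  have [n xn] : exists n, Num.max `|x.1| `|x.2| <= n%:R.
    by eexists; apply: ltW; apply: archi_boundP; rewrite le_max normr_ge0.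
  move: xn; rewrite ge_max => /andP[x1 x2].
  by exists n => //; split; rewrite /= in_itv/= -ler_norml.
move=> n; split; first exact: measurableX.
have H : (@lebesgue_measure R `[(- n%:R)%R, n%:R%R]%classic < +oo)%E.
  by rewrite lebesgue_measure_itv/=; case: ifP => _; rewrite ltry.
pose I : set (measurableTypeR R) := `[- n%:R, n%:R]%classic.
have mI : measurable I by exact: measurable_itv.
have -> : leb2 R (I `*` I) = (lebesgue_measure I * lebesgue_measure I)%E.
  by apply: product_measure1E.
by apply: lte_mul_pinfty => //; rewrite ge0_fin_numE.
Qed.

HB.instance Definition _ (R : realType) :=
  Measure_isSigmaFinite.Build _ _ _ (leb2 R) (sigma_finite_leb2 R).

(** * Affine changes of variables in R^3 *)

Section Affine.
Context {R : realType}.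
Variables (a : R3 R) (c : R).
Hypothesis c0 : 0 < c.

Lemma leb3_affine (A : set (M3 R)) : measurable A ->
  (leb3 ((fun y : R3 R => a + c *: y)%R @^-1` A) = (c ^- 3)%:E * leb3 A)%E.
Proof.
move=> mA.
have cV0 : 0 < c^-1 by rewrite invr_gt0.
have mT (b : R) : measurable_fun setT
    ((fun x => b + c * x) : measurableTypeR R -> measurableTypeR R).
  have : measurable_fun setT (fun x : R => b + c * x) by apply: measurable_funD.
  by [].
have h (b : R) (B : set (measurableTypeR R)) : measurable B ->
    (lebesgue_measure ((fun x => b + c * x)%R @^-1` B) = (c^-1)%:E * lebesgue_measure B)%E.
  by move=> mB; exact: lebesgue_measure_affine.
have h12 := product_measure_image _ _ _ _ _ (@lebesgue_measure R) (@lebesgue_measure R)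
  _ _ _ _ cV0 cV0 (mT a.1.1) (mT a.1.2) (h a.1.1) (h a.1.2).
have h123 := product_measure_image _ _ _ _ _
  (leb2 R) (@lebesgue_measure R) _ _ _ _ (mulr_gt0 cV0 cV0) cV0
  (measurable_fun_pair (measurableT_comp (mT a.1.1) measurable_fst)
     (measurableT_comp (mT a.1.2) measurable_snd)) (mT a.2) h12 (h a.2).
have -> : c ^- 3 = c^-1 * c^-1 * c^-1 by rewrite -exprVn !exprS expr0 mulr1 mulrA.
exact: h123.
Qed.

Lemma measurable_affine : measurable_fun setT ((fun y : R3 R => a + c *: y) : M3 R -> M3 R).
Proof.
have mT (b : R) : measurable_fun setT
    ((fun x => b + c * x) : measurableTypeR R -> measurableTypeR R).
  have : measurable_fun setT (fun x : R => b + c * x) by apply: measurable_funD.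
  by [].
exact: (measurable_fun_pair
  (measurableT_comp (measurable_fun_pair (measurableT_comp (mT a.1.1) measurable_fst)
     (measurableT_comp (mT a.1.2) measurable_snd)) measurable_fst)
  (measurableT_comp (mT a.2) measurable_snd)).
Qed.

Lemma ge0_integral_affine (f : M3 R -> \bar R) :
  measurable_fun setT f -> (forall x, 0 <= f x)%E ->
  (\int[leb3]_y f (a + c *: y : R3 R)%R = (c ^- 3)%:E * \int[leb3]_y f y)%E.
Proof.
move=> mf f0.
have k0 : 0 <= c ^- 3 by rewrite invr_ge0 exprn_ge0 // ltW.
rewrite -[c ^- 3]/((NngNum k0)%:num) -ge0_integral_mscale//.
rewrite -(ge0_integral_pushforward measurable_affine leb3 measurableT mf) => [|? _]; last exact: f0.
by apply: eq_measure_integral => [|mT A mA _]; [exact: measurable_affine|exact: leb3_affine].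
Qed.

Lemma integrable_affine (f : R3 R -> R) : leb3.-integrable setT (EFin \o f) ->
  leb3.-integrable setT (EFin \o (fun y => f (a + c *: y))).
Proof.
move=> /integrableP[mf fi]; apply/integrableP; split.
  exact: measurableT_comp mf measurable_affine.
rewrite (@ge0_integral_affine (abse \o (EFin \o f))) //.
- by apply: lte_mul_pinfty fi => //; rewrite lee_fin invr_ge0 exprn_ge0 // ltW.
- exact: measurableT_comp.
- by move=> x /=; rewrite lee_fin.
Qed.

Lemma Rintegral_affine (f : R3 R -> R) : leb3.-integrable setT (EFin \o f) ->
  \int[leb3]_y f (a + c *: y) = c ^- 3 * \int[leb3]_y f y.
Proof.
move=> fi; have /integrableP[mf _] := fi.
(* Positive and negative parts are transformed separately; integrability makes both integrals
   finite, so their extended difference is a real one. *)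
rewrite /Rintegral [in LHS]integralE [in RHS]integralE.
have -> : (\int[leb3]_x (fun x0 => (f (a + c *: x0))%:E)^\+ x =
    (c ^- 3)%:E * \int[leb3]_x (EFin \o f)^\+ x)%E.
  rewrite -(ge0_integral_affine ((EFin \o f)^\+)%E (measurable_funepos mf) (funepos_ge0 _)).
  by apply: eq_integral => x _; rewrite unlock.
have -> : (\int[leb3]_x (fun x0 => (f (a + c *: x0))%:E)^\- x =
    (c ^- 3)%:E * \int[leb3]_x (EFin \o f)^\- x)%E.
  rewrite -(ge0_integral_affine ((EFin \o f)^\-)%E (measurable_funeneg mf) (funeneg_ge0 _)).
  by apply: eq_integral => x _; rewrite unlock.
have := integrable_pos_fin_num measurableT fi.
have := integrable_neg_fin_num measurableT fi.
rewrite -[X in (_ - \int[_]_(x in _) X^\- x)%E]/(EFin \o f).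
rewrite -[X in (\int[_]_(x in _) X^\+ x - _)%E]/(EFin \o f).
do 2 case: (\int[_]_(x in _) _)%E => //.
by move=> r s _ _ /=; rewrite mulrBr.
Qed.

End Affine.

(** * Differentiation under the integral and integration by parts *)

Section BoundedContinuous.
Context {R : realType}.
Implicit Types (g h k : R3 R -> R).

Lemma continuous_measurable_M3 h : continuous h ->
  measurable_fun (setT : set (M3 R)) (h : M3 R -> R).
Proof. by move=> /continuous_measurable_R3. Qed.

Lemma integrable_boundedM k g (M : R) :
  continuous k -> (forall x, `|k x| <= M) ->
  leb3.-integrable setT (EFin \o g) ->
  leb3.-integrable setT (EFin \o (fun y => k y * g y)).
Proof.
move=> ck kM ig; have /integrableP[/measurable_EFinP mg _] := ig.
have M0 : 0 <= M by apply: le_trans (kM 0).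
apply: (le_integrable measurableT _ _ (integrableZl measurableT M ig)).
- apply/measurable_EFinP; apply: measurable_funM => //.
  exact: continuous_measurable_M3.
- by move=> x _ /=; rewrite lee_fin !normrM ler_pM// (le_trans (kM x))// ler_norm.
Qed.

(** Turns a directional derivative into an ordinary derivative along a line, where one-variable
    theorems apply. *)
Lemma partial_shift i h z (s : R) : derivable h (s *: unit_vec i + z) (unit_vec i) ->
  is_derive s (1 : R) (fun t : R => h (t *: unit_vec i + z))
    (partial i h (s *: unit_vec i + z)).
Proof.
move=> dh.
have E : (fun t : R => t^-1 *: (h ((t *: (1:R) + s) *: unit_vec i + z) - h (s *: unit_vec i + z)))
   = (fun t : R => t^-1 *: ((h \o shift (s *: unit_vec i + z)) (t *: unit_vec i) - h (s *: unit_vec i + z))).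
  by apply/funext => t /=; rewrite -[t *: (1 : R)]/(t * 1) mulr1 scalerDl addrA.
apply: DeriveDef.
  by move: dh; rewrite /derivable -E.
by rewrite /partial /derive -E.
Qed.

(** Along the line through x in direction i the derivative of the integrand is dominated by the
    integrable M |g|. The map [T] allows for both the translates x + y and the arguments x - c y of
    the kernel. *)
Lemma is_derive_integral i h g (T : R3 R -> R3 R) (M : R) :
  continuous h -> (forall x, `|h x| <= M) ->
  (forall x, derivable h x (unit_vec i)) -> (forall x, `|partial i h x| <= M) ->
  continuous T ->
  leb3.-integrable setT (EFin \o g) ->
  forall x, is_derive x (unit_vec i)
    (fun x => \int[leb3]_y (h (x + T y) * g y))
    (\int[leb3]_y (partial i h (x + T y) * g y)).
Proof.
move=> ch hM dh pM cT ig x.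
have M0 : 0 <= M by apply: le_trans (hM 0).
pose f (s : R) (y : M3 R) : R := h (s *: unit_vec i + (x + T y)) * g y.
have df s y : is_derive s (1:R) (f ^~ y) (partial i h (s *: unit_vec i + (x + T y)) * g y).
  have ds := partial_shift i h (x + T y) s (dh _).
  have -> : f ^~ y = g y *: (fun t => h (t *: unit_vec i + (x + T y))).
    by apply/funext => t; rewrite /f mulrC.
  rewrite mulrC; exact: is_deriveZ.
have pfE s y : partial1of2 f s y = partial i h (s *: unit_vec i + (x + T y)) * g y.
  by rewrite partial1of2E; have [_ ->] := df s y.
have If s : leb3.-integrable setT (EFin \o f s).
  apply: (integrable_boundedM _ _ M) => // y.
  apply: continuous_comp; last exact: ch.
  apply: (@continuousD _ _ _ (fun=> s *: unit_vec i) (fun y => x + T y)).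
    exact: cst_continuous.
  apply: (@continuousD _ _ _ (fun=> x) T); first exact: cst_continuous.
  exact: cT.
have H := @cvg_differentiation_under_integral R _ _ leb3 f setT measurableT 0 (-1) 1
  _ (fun s _ => If s) _ (fun y => M * `|g y|) _ _ _.
have {H} H : h0^-1 *: ((\int[leb3]_y f (h0 + 0) y) - \int[leb3]_y f 0 y) @[h0 --> 0^'] -->
     \int[leb3]_y partial1of2 f 0 y.
  apply: H.
  - by rewrite /= in_itv/= ltrN10 ltr01.
  - by move=> s y _ _; have [] := df s y.
  - by move=> y; rewrite mulr_ge0.
  - have := integrableZl measurableT M (integrable_abse ig).
    exact: eq_integrable.
  - by move=> s y _ _; rewrite pfE normrM ler_wpM2r.
have E : \int[leb3]_y partial1of2 f 0 y = \int[leb3]_y (partial i h (x + T y) * g y).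
  by apply: eq_Rintegral => y _; rewrite pfE scale0r add0r.
rewrite E in H.
have E2 : (fun h0 : R => h0^-1 *: ((\int[leb3]_y f (h0 + 0) y) - \int[leb3]_y f 0 y)) =
  (fun h0 : R => h0^-1 *: (((fun x => \int[leb3]_y (h (x + T y) * g y)) \o shift x) (h0 *: unit_vec i)
     - \int[leb3]_y (h (x + T y) * g y))).
  apply/funext => h0 /=; congr (_ *: (_ - _)); apply: eq_Rintegral => y _.
    by rewrite /f addr0 addrA.
  by rewrite /f scale0r add0r.
rewrite E2 in H.
apply: DeriveDef; first by apply/cvg_ex; eexists; exact: H.
by apply/cvg_lim.
Qed.
End BoundedContinuous.

(** * Bounded C^1 functions: affine substitution and integration by parts *)

Section C1Bounded.
Context {R : realType}.
Implicit Types (f g w phi : R3 R -> R).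

(** Converse of [partial_shift] at parameter 0; it lets partial derivatives be computed by the
    one-variable chain rule. *)
Lemma is_derive_line f i x (l : R) :
  is_derive (0 : R) (1 : R) (fun s : R => f (s *: unit_vec i + x)) l ->
  is_derive x (unit_vec i) f l.
Proof.
have E : (fun t : R => t^-1 *: (f ((t *: (1 : R) + 0) *: unit_vec i + x) - f (0 *: unit_vec i + x)))
   = (fun t : R => t^-1 *: ((f \o shift x) (t *: unit_vec i) - f x)).
  by apply/funext => t /=; rewrite -[t *: (1 : R)]/(t * 1) mulr1 addr0 scale0r add0r.
move=> [d1 d2]; apply: DeriveDef.
  by move: d1; rewrite /derivable E.
by rewrite -d2 /derive E.
Qed.

Lemma partial_affine f i (a : R3 R) (b : R) x :
  (forall y, derivable f y (unit_vec i)) ->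
  is_derive x (unit_vec i) (fun y => f (a + b *: y)) (b * partial i f (a + b *: x)).
Proof.
move=> df; apply: is_derive_line.
rewrite (_ : (fun s => _) = (fun t : R => f (t *: unit_vec i + (a + b *: x))) \o *%R b); last first.
  by apply/funext => s /=; rewrite scalerDr scalerA addrCA.
rewrite mulrC; apply: is_derive1_comp; last first.
  rewrite -[X in is_derive _ _ _ X]mulr1; exact: is_deriveZ.
rewrite mulr0; have := partial_shift i f (a + b *: x) 0 (df _).
by rewrite scale0r add0r.
Qed.

(** This class contains the test functions and the mollifiers, is stable under affine substitution
    and scaling, and permits differentiation under the integral. *)
Definition C1_bounded f := exists M : R, [/\ continuous f,
  forall x, `|f x| <= M,
  forall i x, derivable f x (unit_vec i),
  forall i, continuous (partial i f)
  & forall i x, `|partial i f x| <= M].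

Lemma continuous_affine (a : R3 R) (b : R) : continuous (fun y : R3 R => a + b *: y).
Proof.
move=> y; apply: continuousD; first exact: cst_continuous.
exact: scaler_continuous.
Qed.

Lemma continuous_comp_affine f (a : R3 R) (b : R) :
  continuous f -> continuous (fun y : R3 R => f (a + b *: y)).
Proof.
by move=> cf x; apply: continuous_comp; [exact: continuous_affine|exact: cf].
Qed.

Lemma partial_affineE f i (a : R3 R) (b : R) : C1_bounded f ->
  partial i (fun y => f (a + b *: y)) = (fun x => b * partial i f (a + b *: x)).
Proof.
move=> [M [_ _ df _ _]]; apply/funext => x.
by have [_ /= <-] := partial_affine f i a b x (df i).
Qed.

Lemma C1_bounded_affine f (a : R3 R) (b : R) :
  C1_bounded f -> C1_bounded (fun y => f (a + b *: y)).
Proof.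
move=> Cf; have [M [cf fM df cpf pfM]] := Cf.
exists (Num.max M (`|b| * M)); split.
- exact: continuous_comp_affine.
- by move=> x; rewrite le_max fM.
- by move=> i x; have [] := partial_affine f i a b x (df i).
- move=> i; rewrite partial_affineE// => x.
  apply: cvgM; first exact: cvg_cst.
  exact: continuous_comp_affine (cpf i) x.
- by move=> i x; rewrite partial_affineE// le_max normrM ler_wpM2l ?orbT.
Qed.

(** Translation invariance gives \int phi(x + y) w(y) dy = \int w(y - x) phi(y) dy; differentiating
    both sides at x = 0 moves the derivative from phi to w, with a sign. *)
Lemma Rintegral_by_parts i w phi :
  C1_bounded w -> C1_bounded phi ->
  leb3.-integrable setT (EFin \o w) -> leb3.-integrable setT (EFin \o phi) ->
  \int[leb3]_y (w y * partial i phi y) = - \int[leb3]_y (partial i w y * phi y).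
Proof.
move=> Cw Cp iw ip.
have [Mp [cp pM dp _ ppM]] := Cp.
(* The reflection writes w(y - x) as w'(x - y), where x enters with a plus sign as
   [is_derive_integral] requires. *)
pose w' x := w (0 + (-1) *: x).
have Cw' : C1_bounded w' by exact: C1_bounded_affine.
have [Mw [cw wM dw _ pwM]] := Cw'.
have cid : continuous (id : R3 R -> R3 R) by move=> y; exact: cvg_id.
have A := is_derive_integral i phi w id Mp cp pM (dp i) (ppM i) cid iw 0.
have B := is_derive_integral i w' phi (fun y => 0 + (-1) *: y) Mw cw wM (dw i) (pwM i)
  (continuous_affine 0 (-1)) ip 0.
have E x : \int[leb3]_y (phi (x + y) * w y) = \int[leb3]_y (w' (x + (0 + (-1) *: y)) * phi y).
  have [Mw0 [cw0 w0M _ _ _]] := Cw.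
  pose f z := w ((- x) + 1 *: z) * phi z.
  transitivity (\int[leb3]_y f (x + 1 *: y)).
    by apply: eq_Rintegral => y _; rewrite /f !scale1r addKr mulrC.
  rewrite Rintegral_affine//; last first.
    apply: (integrable_boundedM _ _ Mw0) => //.
    exact: continuous_comp_affine.
  rewrite expr1n invr1 mul1r; apply: eq_Rintegral => y _.
  by rewrite /f /w' !add0r !scaleN1r opprD opprK scale1r.
have [_ A2] := A; have [_ B2] := B.
transitivity (\int[leb3]_y (partial i phi (0 + y) * w y)).
  by apply: eq_Rintegral => y _; rewrite add0r mulrC.
rewrite -A2.
rewrite (_ : (fun x => _) = (fun x => \int[leb3]_y (w' (x + (0 + (-1) *: y)) * phi y))); last exact/funext.
rewrite B2 /w' -[RHS]mulN1r -RintegralZl//; last first.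
  have [Mw0 [_ _ _ cpw pw0M]] := Cw.
  exact: integrable_boundedM (cpw i) (pw0M i) ip.
apply: eq_Rintegral => y _.
by rewrite partial_affineE// !add0r !scaleN1r opprK mulrA.
Qed.

End C1Bounded.

(** * Functions on sets of finite measure *)

Section FiniteMeasure.
Context {R : realType}.
Implicit Types (A : set (R3 R)) (f : R3 R -> R).

(** A set bounded in the sup norm lies in a cube [-n, n]^3, whose measure is a product of three
    finite lengths. *)
Lemma leb3_bounded (A : set (M3 R)) : measurable A -> bounded_set (A : set (R3 R)) ->
  (leb3 A < +oo)%E.
Proof.
move=> mA bA.
have [N [_ /(_ (Num.max 0 N + 1))]] := bA.
rewrite ltr_pwDr// ?le_max ?lexx ?orbT// => /(_ isT).
set n := _ + 1 => An.
pose I : set (measurableTypeR R) := `[- n, n]%classic.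
have mI : measurable I by exact: measurable_itv.
have I_lty : (lebesgue_measure I < +oo)%E.
  by rewrite /I lebesgue_measure_itv/=; case: ifP => _; rewrite ltry.
have E2 : leb2 R (I `*` I) = (lebesgue_measure I * lebesgue_measure I)%E.
  by apply: product_measure1E.
have E3 : leb3 ((I `*` I) `*` I) = (leb2 R (I `*` I) * lebesgue_measure I)%E.
  by apply: product_measure1E => //; exact: measurableX.
have AI : A `<=` (I `*` I) `*` I.
  move=> x /An/=; rewrite !prod_normE/= !ge_max => /andP[/andP[h1 h2] h3].
  by split; [split|]; rewrite /I/= in_itv/= -ler_norml.
have mIII : measurable ((I `*` I) `*` I : set (M3 R)) by do 2 apply: measurableX => //.
apply: (@le_lt_trans _ _ (leb3 ((I `*` I) `*` I))).
  by apply: le_measure; rewrite ?inE.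
have I_fin : lebesgue_measure I \is a fin_num by rewrite ge0_fin_numE.
rewrite E3 E2; apply: lte_mul_pinfty; first by rewrite mule_ge0.
  exact: fin_numM.
exact: I_lty.
Qed.

Lemma bounded_integrable_on (A : set (M3 R)) f (M : R) : measurable A -> (leb3 A < +oo)%E ->
  continuous f -> (forall x, `|f x| <= M) -> leb3.-integrable A (EFin \o f).
Proof.
move=> mA Aoo cf fM; apply: measurable_bounded_integrable => //.
  by apply: measurable_funTS; exact: continuous_measurable_M3.
exists M; split; first exact: num_real.
by move=> N MN x _ /=; apply: le_trans (ltW MN).
Qed.

Lemma integrable_restrict (A : set (M3 R)) f : measurable A ->
  leb3.-integrable A (EFin \o f) <-> leb3.-integrable setT (EFin \o (f \_ A)).
Proof.
move=> mA; rewrite -restrict_EFin.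
exact: (@integrable_mkcond _ _ R leb3 A (EFin \o f) mA).
Qed.

Lemma L2_bounded (A : set (M3 R)) f (M : R) : measurable A -> (leb3 A < +oo)%E ->
  continuous f -> (forall x, `|f x| <= M) -> L2 A f.
Proof.
move=> mA Aoo cf fM; split.
  by apply: measurable_funTS; exact: continuous_measurable_R3.
rewrite /finite_norm unlock; apply: poweR_lty.
have If2 : leb3.-integrable A (EFin \o (fun x => f x ^+ 2)).
  apply: (bounded_integrable_on _ _ (M ^+ 2)) => //.
    by move=> x; under eq_fun do rewrite expr2; apply: cvgM; exact: cf.
  by move=> x; rewrite normrX lerXn2r ?nnegrE// (le_trans _ (fM x)).
(* The norm is defined with real powers of |f|; on A the power is f^2, and outside A both integrands
   are 0. *)
have := (integrable_restrict _ _ mA).1 If2.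
move=> /integrableP[_]; apply: le_lt_trans.
rewrite le_eqVlt; apply/orP; left; apply/eqP; apply: eq_integral => x _ /=.
rewrite !patchE; case: ifP => xA /=; last by rewrite normr0 powR0// abse0.
by rewrite normrX -(powR_mulrn _ (normr_ge0 _)).
Qed.

(** On a set of finite measure 1 + f^2 is integrable, and it dominates |f| because (|f| - 1)^2 >=
    0. *)
Lemma L2_integrable (A : set (M3 R)) f : measurable A -> (leb3 A < +oo)%E ->
  L2 A f -> leb3.-integrable A (EFin \o f).
Proof.
move=> mA Aoo [mf f2].
have mf' : measurable_fun A (f : M3 R -> R) by exact: mf.
have mp : measurable_fun setT (patch (fun=> 0) A f : M3 R -> R).
  exact/(measurable_restrictT _ mA).
have : leb3.-integrable setT (EFin \o (fun x => patch (fun=> 0) A f x ^+ 2)).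
  by apply: Lfun2_integrable_sqr; rewrite inE/=; apply/andP; rewrite !inE.
move=> I2.
have I1 : leb3.-integrable A (cst 1%E).
  apply: (bounded_integrable_on _ (cst 1) 1 mA Aoo); first by move=> x; exact: cst_continuous.
  by move=> x; rewrite normr1.
have I2' : leb3.-integrable A (EFin \o (fun x => patch (fun=> 0) A f x ^+ 2)).
  by apply: integrableS I2.
apply: (le_integrable mA _ _ (integrableD mA I1 I2')).
  exact/measurable_EFinP.
move=> x Ax /=; rewrite patchE mem_set// lee_fin.
have fx : `|f x| <= 1 + f x ^+ 2.
  have : 0 <= (`|f x| - 1) ^+ 2 by exact: sqr_ge0.
  rewrite -(real_normK (num_real (f x))).
  have := normr_ge0 (f x); nra.
by apply: le_trans fx _; exact: ler_norm.
Qed.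
End FiniteMeasure.

(** * Weak derivatives of bounded C^1 functions *)

Section TestFunctions.
Context {R : realType}.
Implicit Types (A : set (R3 R)) (f w phi : R3 R -> R).

Lemma partial_eq0 A f i x : open A -> (forall y, A y -> f y = 0) -> A x ->
  partial i f x = 0.
Proof.
move=> oA f0 Ax; rewrite /partial.
rewrite (@near_eq_derive _ _ _ f (cst 0)).
  by rewrite derive_cst.
have : nbhs x A by exact: open_nbhs_nbhs.
by apply: filterS => y /f0.
Qed.

Lemma compact_support_bounded (K : set (R3 R)) f : compact K -> continuous f ->
  (forall x, ~ K x -> f x = 0) -> exists M : R, forall x, `|f x| <= M.
Proof.
move=> cK cf f0.
(* [bounded_set] gives a bound only for numbers strictly above M; the maximum with 0 makes the
   chosen one valid off K too. *)
have [/= M [_ /(_ (Num.max 0 M + 1))]] : bounded_set (f @` K).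
  apply: compact_bounded; apply: continuous_compact cK.
  exact: continuous_subspaceT.
rewrite ltr_pwDr// ?le_max ?lexx ?orbT// => /(_ isT) fM.
exists (Num.max 0 M + 1) => x.
have [Kx|nKx] := pselect (K x); first by apply: fM; exists x.
by rewrite f0// normr0 addr_ge0// le_max lexx.
Qed.

Lemma closed_measurable_M3 (K : set (R3 R)) : closed K -> measurable (K : set (M3 R)).
Proof.
move=> cK.
have : measurable (~` K) by apply: open_measurable_R3; exact: closed_openC.
by move/measurableC; rewrite setCK.
Qed.

Section Support.
Variables (A : set (R3 R)) (phi : R3 R -> R).
Hypothesis tphi : test_function A phi.
Let K := closure [set x | phi x != 0].

Let cK : compact K. Proof. by have [_ []] := tphi. Qed.

Let openNK : open (~` K).
Proof. by apply: closed_openC; exact: closed_closure. Qed.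

Let phi0 x : ~ K x -> phi x = 0.
Proof.
move=> nKx; apply/eqP; apply: contrapT => /negP p0.
by apply: nKx; exact: subset_closure.
Qed.

Let partial0 i x : ~ K x -> partial i phi x = 0.
Proof. exact: (partial_eq0 (~` K) phi i x openNK phi0). Qed.

Lemma test_function_eq0 x : ~ A x -> phi x = 0.
Proof. by have [_ [_ KA]] := tphi; move=> nAx; apply: phi0 => /KA. Qed.

Lemma test_function_partial_eq0 i x : ~ A x -> partial i phi x = 0.
Proof. by have [_ [_ KA]] := tphi; move=> nAx; apply: partial0 => /KA. Qed.

(** The function and its three partials are continuous and vanish off the compact [K], so each is
    bounded; the largest bound serves all. *)
Lemma test_function_C1_bounded : C1_bounded phi.
Proof.
have [/(_ 1%N)/=[cphi dphi cpphi] _] := tphi.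
have [M phiM] := compact_support_bounded _ _ cK cphi phi0.
have pb i := compact_support_bounded _ _ cK (cpphi i) (partial0 i).
have [M0 pM0] := pb 0; have [M1 pM1] := pb 1; have [M2 pM2] := pb 2.
exists (Num.max M (Num.max M0 (Num.max M1 M2))); split => //.
  by move=> x; rewrite le_max phiM.
move=> i x; rewrite !le_max.
suff : [|| `|partial i phi x| <= M0, `|partial i phi x| <= M1 | `|partial i phi x| <= M2].
  by case/or3P => ->; rewrite ?orbT.
case: i => -[|[|[|//]]] p.
- by rewrite (_ : Ordinal p = 0) ?pM0//; exact/val_inj.
- by rewrite (_ : Ordinal p = 1) ?pM1 ?orbT//; exact/val_inj.
- by rewrite (_ : Ordinal p = 2) ?pM2 ?orbT//; exact/val_inj.
Qed.

Lemma test_function_integrable : leb3.-integrable setT (EFin \o phi).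
Proof.
have mK : measurable (K : set (M3 R)).
  by apply: closed_measurable_M3; exact: closed_closure.
have [M [cphi phiM _ _ _]] := test_function_C1_bounded.
have := (integrable_restrict _ _ mK).1 (bounded_integrable_on _ _ _ mK
  (leb3_bounded _ mK (compact_bounded cK)) cphi phiM).
rewrite (_ : phi \_ K = phi)//; apply/funext => x; rewrite patchE.
case: ifPn => // /negP; rewrite inE => /phi0 ->//.
Qed.

End Support.

Lemma Rintegral_eq0_outside (A : set (M3 R)) f : (forall x, ~ A x -> f x = 0) ->
  \int[leb3]_(x in A) f x = \int[leb3]_x f x.
Proof.
move=> f0; rewrite Rintegral_mkcond; congr Rintegral; apply/funext => x.
by rewrite patchE; case: ifPn => // /negP; rewrite inE => /f0.
Qed.

(** The test function and its partials vanish off A, so both integrals extend to R^3, where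
    integration by parts has no boundary term. *)
Lemma C1_bounded_weak_partial (A : set (M3 R)) w i :
  C1_bounded w -> leb3.-integrable setT (EFin \o w) ->
  weak_partial A i w (partial i w).
Proof.
move=> Cw iw phi tphi.
rewrite Rintegral_eq0_outside; last first.
  by move=> x nAx; rewrite (test_function_partial_eq0 _ _ tphi i _ nAx) mulr0.
rewrite [in RHS]Rintegral_eq0_outside; last first.
  by move=> x nAx; rewrite (test_function_eq0 _ _ tphi _ nAx) mulr0.
apply: Rintegral_by_parts => //; first exact: test_function_C1_bounded tphi.
exact: test_function_integrable tphi.
Qed.

Lemma C1_bounded_H1 (A : set (M3 R)) w : measurable A -> (leb3 A < +oo)%E ->
  C1_bounded w -> leb3.-integrable setT (EFin \o w) -> H1 A w.
Proof.
move=> mA Aoo Cw iw; have [M [cw wM _ cpw pwM]] := Cw.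
split; first exact: L2_bounded wM.
move=> i; exists (partial i w); first exact: L2_bounded (pwM i).
exact: C1_bounded_weak_partial.
Qed.

Lemma dotE (x y : R3 R) : dot x y = x.1.1 * y.1.1 + x.1.2 * y.1.2 + x.2 * y.2.
Proof. by rewrite /dot !big_ord_recl big_ord0 addr0 /coordinate/= addrA. Qed.

Lemma coordinate3 (x : R3 R) :
  (coordinate 0 x = x.1.1) * (coordinate 1 x = x.1.2) * (coordinate 2 x = x.2).
Proof. by []. Qed.

(** Both sides expand into six integrals of products of one component with a partial of another;
    these match pairwise by the weak partial derivatives. *)
Lemma C1_bounded_weak_curl (A : set (M3 R)) (W : R3 R -> R3 R) :
  measurable A ->
  (forall j, C1_bounded (coordinate j \o W)) ->
  (forall j, leb3.-integrable setT (EFin \o (coordinate j \o W))) ->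
  weak_curl A W (curl W).
Proof.
move=> mA CW iW Phi tPhi.
pose w j := coordinate j \o W; pose p j := coordinate j \o Phi.
have i1 j i k : leb3.-integrable A (EFin \o (fun x => w j x * partial i (p k) x)).
  have [N [_ _ _ cp pN]] := test_function_C1_bounded _ _ (tPhi k).
  have := integrable_boundedM _ _ _ (cp i) (pN i) (iW j).
  move/(integrableS measurableT mA (@subsetT _ _)).
  by apply: eq_integrable => // x _ /=; rewrite mulrC.
have i2 j i k : leb3.-integrable A (EFin \o (fun x => partial i (w j) x * p k x)).
  have [N [_ _ _ cp pN]] := CW j.
  have := integrable_boundedM _ _ _ (cp i) (pN i) (test_function_integrable _ _ (tPhi k)).
  exact/(integrableS measurableT mA (@subsetT _ _)).
pose I j i k := \int[leb3]_(x in A) (w j x * partial i (p k) x).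
pose J j i k := \int[leb3]_(x in A) (partial i (w j) x * p k x).
have E j i k : I j i k = - J j i k.
  exact: (C1_bounded_weak_partial A (w j) i (CW j) (iW j) (p k) (tPhi k)).
have D6 (a b c d e f : R3 R -> R) : leb3.-integrable A (EFin \o a) ->
   leb3.-integrable A (EFin \o b) -> leb3.-integrable A (EFin \o c) ->
   leb3.-integrable A (EFin \o d) -> leb3.-integrable A (EFin \o e) ->
   leb3.-integrable A (EFin \o f) ->
   \int[leb3]_(x in A) ((a x - b x) + (c x - d x) + (e x - f x)) =
   (\int[leb3]_(x in A) a x - \int[leb3]_(x in A) b x) +
   (\int[leb3]_(x in A) c x - \int[leb3]_(x in A) d x) +
   (\int[leb3]_(x in A) e x - \int[leb3]_(x in A) f x).
  move=> ia ib ic id ie iif.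
  have iab := integrableB mA ia ib; have icd := integrableB mA ic id.
  have ief := integrableB mA ie iif; have iabcd := integrableD mA iab icd.
  by rewrite RintegralD// RintegralD// !RintegralB.
have L : \int[leb3]_(x in A) dot (W x) (curl Phi x) =
    (I 0 1 2 - I 0 2 1) + (I 1 2 0 - I 1 0 2) + (I 2 0 1 - I 2 1 0).
  rewrite -(D6 _ _ _ _ _ _ (i1 0 1 2) (i1 0 2 1) (i1 1 2 0) (i1 1 0 2) (i1 2 0 1) (i1 2 1 0)).
  by apply: eq_Rintegral => x _; rewrite dotE /curl/= !mulrBr.
have {D6} L' : \int[leb3]_(x in A) dot (curl W x) (Phi x) =
    (J 2 1 0 - J 1 2 0) + (J 0 2 1 - J 2 0 1) + (J 1 0 2 - J 0 1 2).
  rewrite -(D6 _ _ _ _ _ _ (i2 2 1 0) (i2 1 2 0) (i2 0 2 1) (i2 2 0 1) (i2 1 0 2) (i2 0 1 2)).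
  by apply: eq_Rintegral => x _; rewrite dotE /curl/= !mulrBl.
(* with the bodies in place, rewriting unfolds the derivatives and diverges *)
rewrite L L'; clearbody I J; rewrite !E.
ring.
Qed.

End TestFunctions.

(** * The bump function *)

Section Bump.
Context {R : realType}.
Implicit Types (x : R3 R) (t : R).

(** The classical smooth function flat at 0; the bump is its composition with 1 - |x|^2. *)
Definition psi t : R := if 0 < t then expR (- t^-1) else 0.

Lemma psi_ge0 t : 0 <= psi t.
Proof. by rewrite /psi; case: ifP => // _; exact: expR_ge0. Qed.

Lemma psi_le1 t : psi t <= 1.
Proof.
by rewrite /psi; case: ifP => // t0; rewrite -expR0 ler_expR oppr_le0 invr_ge0 ltW.
Qed.

(** The third power is one more than the t^2 dividing [psi] in its derivative, so that the
    derivative is O(t) at 0. *)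
Lemma psi_le t : psi t <= 27 * `|t| ^+ 3.
Proof.
rewrite /psi; case: ifPn => [t0|_]; last by rewrite mulr_ge0// exprn_ge0.
(* cube the inequality y <= exp y at y = 1 / (3 t) *)
pose y := t^-1 / 3.
have y0 : 0 < y by rewrite divr_gt0 ?invr_gt0.
have yE : y <= expR y by apply: le_trans (expR_ge1Dx y); rewrite lerDr.
have -> : - t^-1 = - (y + y + y) by rewrite /y; field; rewrite gt_eqF.
rewrite expRN !expRD gtr0_norm//.
have -> : 27 * t ^+ 3 = (y * y * y)^-1 by rewrite /y; field; rewrite gt_eqF.
have e0 : 0 < expR y := expR_gt0 y.
have y3 : y * y * y <= expR y * expR y * expR y.
  have y2 : y * y <= expR y * expR y by apply: ler_pM => //; exact: ltW.
  by apply: ler_pM => //; [rewrite mulr_ge0 ?ltW|exact: ltW].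
by rewrite lef_pV2 // posrE; apply: mulr_gt0 => //; exact: mulr_gt0.
Qed.

Lemma psi_le_sqr t : `|t| < 1 -> psi t <= `|t| * (27 * `|t|).
Proof.
move=> t1; apply: le_trans (psi_le t) _; move: t1 (normr_ge0 t).
move: `|t| => u u1 u0; rewrite !exprS expr0 mulr1.
have : 0 <= u * u * (1 - u) by rewrite !mulr_ge0// subr_ge0 ltW.
nra.
Qed.

(** The derivative of [psi] on the whole line: for t <= 0 the numerator vanishes, and the quotient
    at 0 is 0. *)
Definition dpsi t := psi t / t ^+ 2.

Lemma dpsi_le t : `|dpsi t| <= 27 * `|t|.
Proof.
rewrite /dpsi; have [->|t0] := eqVneq t 0.
  by rewrite expr0n invr0 mulr0 normr0 mulr0.
rewrite normrM normfV normrX ler_pdivrMr ?exprn_gt0 ?normr_gt0//.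
by rewrite ger0_norm ?psi_ge0// -mulrA -exprS psi_le.
Qed.

Lemma is_derive_psi t : is_derive t (1 : R) psi (dpsi t).
Proof.
have [t0|t0|->] := ltgtP t 0.
- have -> : dpsi t = 0 by rewrite /dpsi /psi ltNge (ltW t0) mul0r.
  apply: (near_eq_is_derive (f := cst 0)).
  near=> s; rewrite /psi ltNge (_ : s <= 0)//.
  by apply/ltW; near: s; exact: lt_nbhsl.
- have D : is_derive t (1 : R) (fun s => expR (- s^-1)) (dpsi t).
    rewrite /dpsi /psi t0.
    apply: is_derive1_comp.
    rewrite (_ : (t ^+ 2)^-1 = - (- (t ^- 2) *: 1)); last first.
      by rewrite scaleNr opprK -[_ *: _]/(_ * _) mulr1.
    apply: is_deriveN; apply: is_deriveV.
    by rewrite gt_eqF.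
  apply: near_eq_is_derive D.
  near=> s; rewrite /psi (_ : 0 < s)//.
  by near: s; exact: lt_nbhsr.
- have d0 : dpsi 0 = 0 by rewrite /dpsi expr0n invr0 mulr0.
  rewrite d0.
  (* At 0 the difference quotient is psi(h)/h, bounded by 27 |h| for |h| < 1. *)
  have H : h^-1 *: (psi (h *: (1 : R) + 0) - psi 0) @[h --> 0^'] --> (0 : R).
    apply: (@cvg_to_0_linear _ _ 27 1) => // h /andP[h0 h1].
    have ph := psi_le_sqr h h1.
    rewrite {2}/psi ltxx subr0 addr0 -[h *: 1]/(h * 1) mulr1.
    rewrite -[_ *: _]/(h^-1 * _) normrM normfV ler_pdivrMl//.
    rewrite ger0_norm ?psi_ge0//; exact: ph.
  apply: DeriveDef; last exact/cvg_lim.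
  by apply/cvg_ex; eexists; exact: H.
Unshelve. all: by end_near. Qed.

Lemma continuous_psi : continuous psi.
Proof.
move=> t; apply: differentiable_continuous; apply/derivable1_diffP.
by have [] := is_derive_psi t.
Qed.

Lemma continuous_dpsi : continuous dpsi.
Proof.
move=> t; have [->|t0] := eqVneq t 0.
  have d0 : dpsi 0 = 0 by rewrite /dpsi expr0n invr0 mulr0.
  apply/cvgrPdist_lt => e e0; rewrite d0.
  have e27 : 0 < e / 27 by rewrite divr_gt0.
  have : \forall s \near (0 : R), `|s| < e / 27 by exact: nbhs0_lt.
  apply: filterS => s; rewrite ltr_pdivlMr// mulrC => se.
  by rewrite sub0r normrN (le_lt_trans (dpsi_le s)).
apply: cvgM; first exact: continuous_psi.
apply: cvgV; first by rewrite expf_neq0.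
exact: exprn_continuous.
Qed.

Definition quad x : R := 1 - dot x x.

(** The bump becomes [psi] of a polynomial, so that no square root has to be differentiated. *)
Lemma bumpE x : Defs.bump x = psi (quad x).
Proof.
have d0 : 0 <= dot x x by rewrite dotE !addr_ge0// -expr2 sqr_ge0.
rewrite /Defs.bump /psi /quad /enorm sqr_sqrtr// subr_gt0.
by rewrite -[X in _ < X]sqrtr1 ltr_sqrt.
Qed.

(** On a coordinate line [quad] is a quadratic polynomial in s, whose linear coefficient is the
    inner derivative for the bump. *)
Lemma quad_line i x (s : R) :
  quad (s *: unit_vec i + x) = quad x + (- 2 * coordinate i x) * s - s ^+ 2.
Proof.
rewrite /quad !dotE /unit_vec /coordinate.
case: i => -[|[|[|//]]] p; rewrite /= -?[_ *: _]/(_ * _); ring.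
Qed.

Lemma is_derive_bump i x :
  is_derive x (unit_vec i) Defs.bump (dpsi (quad x) * (- 2 * coordinate i x)).
Proof.
apply: is_derive_line.
rewrite (_ : (fun s => _) = psi \o
  (fun s => quad x + (- 2 * coordinate i x) * s - s ^+ 2)); last first.
  by apply/funext => s /=; rewrite bumpE quad_line.
apply: is_derive1_comp.
  by rewrite mulr0 expr0n subr0 addr0; exact: is_derive_psi.
rewrite (_ : (fun s => _) = (cst (quad x) + (- 2 * coordinate i x) *: (id : R -> R)) - (id : R -> R) ^+ 2); last first.
  by apply/funext => s; rewrite !fctE.
have D1 : is_derive (0 : R) (1 : R) ((- 2 * coordinate i x) *: (id : R -> R))
    ((- 2 * coordinate i x) *: 1) by exact: is_deriveZ.
have D2 := @is_deriveX _ _ (id : R -> R) 2 (0 : R) (1 : R) 1 (is_derive_id _ _).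
have := is_deriveB (is_deriveD (is_derive_cst (quad x) (0 : R) (1 : R)) D1) D2.
move=> D; apply: (is_derive_eq D).
by rewrite add0r -![_ *: 1]/(_ * 1) !mulr1 [id 0 ^+ 1]/(0 : R) mulr0 subr0.
Qed.

Lemma continuous_coordinate i : continuous (coordinate i : R3 R -> R).
Proof.
move=> x; case: i => -[|[|[|//]]] p.
- by apply: (@continuous_comp _ _ _ fst fst); [exact: cvg_fst|exact: cvg_fst].
- by apply: (@continuous_comp _ _ _ fst snd); [exact: cvg_fst|exact: cvg_snd].
- exact: cvg_snd.
Qed.

Lemma continuous_quad : continuous quad.
Proof.
move=> x; apply: cvgB; first exact: cvg_cst.
rewrite (_ : (fun x => dot x x) = (fun x => coordinate 0 x * coordinate 0 x +
   coordinate 1 x * coordinate 1 x + coordinate 2 x * coordinate 2 x)); last first.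
  by apply/funext => y; rewrite dotE.
rewrite dotE -!coordinate3.
by apply: cvgD; [apply: cvgD|]; apply: cvgM; exact: continuous_coordinate.
Qed.

Lemma coordinate_le1 i x : 0 <= quad x -> `|coordinate i x| <= 1.
Proof.
rewrite /quad dotE subr_ge0 => h.
suff : coordinate i x ^+ 2 <= 1.
  by rewrite -[coordinate i x ^+ 2]real_normK ?num_real// expr_le1.
have := sqr_ge0 x.1.1; have := sqr_ge0 x.1.2; have := sqr_ge0 x.2.
case: i => -[|[|[|//]]] p; rewrite /coordinate/=; nra.
Qed.

Lemma partial_bumpE i : partial i Defs.bump = fun x => dpsi (quad x) * (- 2 * coordinate i x).
Proof. by apply/funext => x; have [_ <-] := is_derive_bump i x. Qed.

Lemma C1_bounded_bump : C1_bounded (@Defs.bump R).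
Proof.
(* Where 0 <= [quad] <= 1 the gradient has factors |dpsi| <= 27 and |2 x_i| <= 2; elsewhere [dpsi]
   vanishes. *)
exists 54; split.
- rewrite (_ : Defs.bump = psi \o quad); last by apply/funext => x; rewrite bumpE.
  by move=> x; apply: continuous_comp; [exact: continuous_quad|exact: continuous_psi].
- move=> x; rewrite bumpE ger0_norm ?psi_ge0//.
  by rewrite (le_trans (psi_le1 _))// ler1n.
- by move=> i x; have [] := is_derive_bump i x.
- move=> i x; rewrite partial_bumpE.
  apply: (@cvgM _ _ _ _ (fun x => dpsi (quad x))).
    exact: (continuous_comp (continuous_quad x) (continuous_dpsi _)).
  by apply: cvgM; [exact: cvg_cst|exact: continuous_coordinate].
- move=> i x; rewrite partial_bumpE.
  have [q0|q0] := lerP 0 (quad x); last first.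
    by rewrite /dpsi /psi ltNge (ltW q0)/= !mul0r normr0.
  have q1 : quad x <= 1.
    by rewrite /quad gerBl dotE !addr_ge0// -expr2 sqr_ge0.
  rewrite normrM [X in _ * X]normrM normrN (_ : 54 = 27 * 2 * 1); last by ring.
  rewrite mulrA; apply: ler_pM => //; last exact: coordinate_le1.
  rewrite normr_nat ler_pM2r// (le_trans (dpsi_le _))// ger0_norm//.
  by rewrite -[leRHS]mulr1 ler_pM2l.
Qed.

Lemma bump_integrable : leb3.-integrable setT (EFin \o @Defs.bump R).
Proof.
(* A sup-norm ball large enough to contain the Euclidean unit ball, outside which the bump is 0. *)
pose B : set (R3 R) := ball 0 2.
have oB : open B by exact: ball_open.
have mB : measurable (B : set (M3 R)) by exact: open_measurable_R3.
have bB : bounded_set B.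
  exists 2; split; first exact: num_real.
  move=> N N2 x; rewrite /B -ball_normE/= sub0r normrN => x2.
  exact/ltW/(lt_trans x2).
have [M [cb bM _ _ _]] := C1_bounded_bump.
have := (integrable_restrict _ _ mB).1 (bounded_integrable_on _ _ _ mB
  (leb3_bounded _ mB bB) cb bM).
rewrite (_ : (@Defs.bump R) \_ B = @Defs.bump R)//; apply/funext => x; rewrite patchE.
case: ifPn => // /negP; rewrite inE => xB.
rewrite bumpE /psi; case: ifPn => // q0; exfalso; apply: xB.
rewrite /B -ball_normE/= sub0r normrN !prod_normE/= !gt_max.
have h i : `|coordinate i x| < 2.
  by rewrite (le_lt_trans (coordinate_le1 i x (ltW q0)))// ltr1n.
by rewrite (h 0) (h 1) (h 2).
Qed.

Lemma bumpN x : Defs.bump (- x) = Defs.bump x.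
Proof. by rewrite !bumpE /quad !dotE/= !mulrNN. Qed.

End Bump.

(** * The smoothing operator *)

Section Kernel.
Context {R : realType}.
Implicit Types (f k g : R3 R -> R) (F : R3 R -> R3 R).

Lemma partial_scaleE (a : R) f i : (forall x, derivable f x (unit_vec i)) ->
  partial i (fun x => a * f x) = (fun x => a * partial i f x).
Proof.
move=> df; apply/funext => x.
have [_ d2] := is_deriveZ a (DeriveDef (df x) erefl).
exact: d2.
Qed.

Lemma C1_bounded_scale (a : R) f : C1_bounded f -> C1_bounded (fun x => a * f x).
Proof.
move=> [M [cf fM df cpf pfM]]; exists (`|a| * M); split.
- by move=> x; apply: cvgM; [exact: cvg_cst|exact: cf].
- by move=> x; rewrite normrM ler_wpM2l.
- move=> i x.
  by have [] := is_deriveZ a (DeriveDef (df i x) erefl).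
- move=> i x; rewrite partial_scaleE//.
  by apply: cvgM; [exact: cvg_cst|exact: cpf].
- by move=> i x; rewrite partial_scaleE// normrM ler_wpM2l.
Qed.

(** The summand 0 gives the argument the form a + b x of the affine lemmas. *)
Lemma mollifierE (e : R) :
  mollifier e = fun x => (e ^- 3 * bump_eta) * Defs.bump (0 + e^-1 *: x).
Proof. by apply/funext => x; rewrite /mollifier /rho mulrA add0r. Qed.

Lemma C1_bounded_mollifier (e : R) : C1_bounded (mollifier e).
Proof.
rewrite mollifierE; apply: C1_bounded_scale; apply: C1_bounded_affine.
exact: C1_bounded_bump.
Qed.

Lemma integrable_scale (a : R) f : leb3.-integrable setT (EFin \o f) ->
  leb3.-integrable setT (EFin \o (fun x => a * f x)).
Proof. by move=> /(integrableZl measurableT a). Qed.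

Lemma mollifier_integrable (e c : R) (x : R3 R) : 0 < e -> 0 < c ->
  leb3.-integrable setT (EFin \o (fun y => mollifier e (x + (- c) *: y))).
Proof.
move=> e0 c0; rewrite mollifierE; apply: integrable_scale.
have ec0 : 0 < e^-1 * c by rewrite mulr_gt0 ?invr_gt0.
have := integrable_affine (- (e^-1 *: x)) _ ec0 _ bump_integrable.
rewrite (_ : (fun y => _) = (fun y => Defs.bump (0 + e^-1 *: (x + (- c) *: y))))//.
(* Evenness of the bump trades the coefficient -c/e for c/e, since the change of variables is stated
   for a positive ratio. *)
apply/funext => y; rewrite -bumpN add0r opprD opprK; congr Defs.bump.
by rewrite scalerDr scalerA mulrN scaleNr.
Qed.

End Kernel.

(** * The smoothed field and its derivatives *)

Section Smoothing.
Context {R : realType}.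
Variable A : set (M3 R).
Hypotheses (mA : measurable A) (Aoo : (leb3 A < +oo)%E).
Variables (chi delta : R).
Hypotheses (chi0 : 0 < chi) (delta0 : 0 < delta) (delta1 : delta < 1).
Let c : R := 1 - delta.
Let c0 : 0 < c. Proof. by rewrite subr_gt0. Qed.
Let k : R3 R -> R := mollifier (delta * chi).
Let Ck : C1_bounded k := C1_bounded_mollifier _.

Lemma L2_field_integrable (F : R3 R -> R3 R) j : L2_field A F ->
  leb3.-integrable setT (EFin \o ((coordinate j \o F) \_ A)).
Proof. by move=> F2; apply/(integrable_restrict _ _ mA)/L2_integrable. Qed.

(** Substituting y = c z undoes the dilation at the cost of the Jacobian c^3. In this form x occurs
    only in the kernel, on which all derivatives then fall. *)
Lemma smoothingE (F : R3 R -> R3 R) j (x : R3 R) : L2_field A F ->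
  coordinate j (smoothing A chi delta F x) =
  c ^+ 3 * \int[leb3]_y (k (x + (- c) *: y) * ((coordinate j \o F) \_ A) y).
Proof.
move=> F2; have [M [ck kM _ _ _]] := Ck.
have cV0 : 0 < c^-1 by rewrite invr_gt0.
pose f y := k (x + (- c) *: y) * ((coordinate j \o F) \_ A) y.
have If : leb3.-integrable setT (EFin \o f).
  apply: (integrable_boundedM _ _ M) => //; last exact: L2_field_integrable.
  exact: continuous_comp_affine.
have := Rintegral_affine 0 _ cV0 f If.
rewrite -exprVn invrK => <-.
transitivity (\int[leb3]_y (k (x - y) *
    coordinate j (dilation delta (zero_extension A F) y))).
  by case: j {f If} => -[|[|[|//]]] p.
apply: eq_Rintegral => y _; rewrite /f add0r scalerA mulNr divff ?gt_eqF//.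
rewrite scaleN1r; congr (_ * _).
rewrite /dilation /zero_extension !patchE; case: ifP => //= _.
by case: j {f If} => -[|[|[|//]]] p.
Qed.

(** Up to the factor c^3, the i-th partial derivative at x of the j-th component of the smoothed
    field. *)
Definition kernel_moment (F : R3 R -> R3 R) (x : R3 R) i j : R :=
  \int[leb3]_y (partial i k (x + (- c) *: y) * ((coordinate j \o F) \_ A) y).

Lemma is_derive_smoothing (F : R3 R -> R3 R) i j (x : R3 R) : L2_field A F ->
  is_derive x (unit_vec i) (coordinate j \o smoothing A chi delta F)
    (c ^+ 3 * kernel_moment F x i j).
Proof.
move=> F2; have [M [ck kM dk cpk pkM]] := Ck.
have D := is_derive_integral i k _ (fun y => 0 + (- c) *: y) M ck kM (dk i) (pkM i)
  (continuous_affine 0 (- c)) (L2_field_integrable F j F2) x.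
have -> : coordinate j \o smoothing A chi delta F = (fun z : R3 R => c ^+ 3 *
    \int[leb3]_y (k (z + (0 + (- c) *: y)) * ((coordinate j \o F) \_ A) y)).
  apply/funext => z; rewrite [LHS](smoothingE F j z F2).
  by under [in RHS]eq_Rintegral do rewrite add0r.
have -> : kernel_moment F x i j = \int[leb3]_y
    (partial i k (x + (0 + (- c) *: y)) * ((coordinate j \o F) \_ A) y).
  by under [in RHS]eq_Rintegral do rewrite add0r.
exact: (is_deriveZ (c ^+ 3) D).
Qed.

Lemma derivable_coordinates (G : R3 R -> R3 R) (x v : R3 R) :
  (forall j, derivable (coordinate j \o G) x v) -> derivable G x v.
Proof.
move=> dG.
have /cvg_ex[/= l0 h0] := dG 0.
have /cvg_ex[/= l1 h1] := dG 1.
have /cvg_ex[/= l2 h2] := dG 2.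
apply/cvg_ex; exists (l0, l1, l2).
rewrite (_ : (fun h => _) = (fun h =>
  (h^-1 *: ((G (h *: v + x)).1.1 - (G x).1.1), h^-1 *: ((G (h *: v + x)).1.2 - (G x).1.2),
   h^-1 *: ((G (h *: v + x)).2 - (G x).2)))); last by apply/funext => h.
exact: (cvg_pair (cvg_pair h0 h1) h2).
Qed.

(** * Commutation of the smoothing with the curl *)

Section Commutation.
Variables (F curlF : R3 R -> R3 R) (x : R3 R).
Hypotheses (F2 : L2_field A F) (curlF2 : L2_field A curlF)
  (curlFE : weak_curl A F curlF) (F0 : zero_tangential_trace A F).

Let w (y : R3 R) : R := k (x + (- c) *: y).
Let W l (y : R3 R) : R3 R := w y *: unit_vec l.

Let Cw : C1_bounded w.
Proof. exact: C1_bounded_affine. Qed.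

Let WE l j : coordinate j \o W l = fun y => (j == l)%:R * w y.
Proof.
apply/funext => y; rewrite /= /W /unit_vec /coordinate.
case: j => -[|[|[|//]]] p /=; rewrite -[_ *: _]/(_ * _) mulrC;
  by congr (_%:R * _); rewrite eq_sym.
Qed.

Let iw : leb3.-integrable setT (EFin \o w).
Proof. by apply: mollifier_integrable => //; exact: mulr_gt0. Qed.

Let partial_w i : partial i w = fun y => - c * partial i k (x + (- c) *: y).
Proof. exact: partial_affineE. Qed.

Let partial_W i j l y : partial i (coordinate j \o W l) y =
  (j == l)%:R * (- c * partial i k (x + (- c) *: y)).
Proof.
have [M [_ _ dw _ _]] := Cw.
by rewrite WE partial_scaleE// partial_w.
Qed.

(** For arbitrary x the support of W may reach the boundary of A, so W need not be a test field:
    this is where the zero tangential trace enters. The work is to check that W is an admissible H^1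
    field with an L^2 curl. *)
Lemma zero_trace_W l : \int[leb3]_(y in A) dot (F y) (curl (W l) y) =
  \int[leb3]_(y in A) dot (curlF y) (W l y).
Proof.
have CW j : C1_bounded (coordinate j \o W l).
  by rewrite WE; exact: C1_bounded_scale.
have iW j : leb3.-integrable setT (EFin \o (coordinate j \o W l)).
  by rewrite WE; exact: integrable_scale.
apply/eqP; rewrite -subr_eq0; apply/eqP; apply: F0 => //.
- by move=> j; exact: C1_bounded_H1.
- have b i j : exists M : R, continuous (partial i (coordinate j \o W l)) /\
      forall y, `|partial i (coordinate j \o W l) y| <= M.
    by have [M [_ _ _ h1 h2]] := CW j; exists M; split.
  (* Each component of curl W is such a difference, continuous and bounded on a set of finite
     measure. *)
  have d i j i' j' : L2 A (fun y => partial i (coordinate j \o W l) y -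
      partial i' (coordinate j' \o W l) y).
    have [M [h1 h2]] := b i j; have [M' [h1' h2']] := b i' j'.
    apply: (L2_bounded _ _ (M + M')) => //.
      by move=> y; apply: cvgB; [exact: h1|exact: h1'].
    by move=> y; rewrite (le_trans (ler_normB _ _))// lerD.
  by case=> -[|[|[|//]]] p; exact: d.
- exact: C1_bounded_weak_curl.
Qed.

(** Integrates the pointwise formula for F . curl W and applies the zero trace. Taking that formula
    as a hypothesis lets one proof serve all three cyclic choices of (l, i, j). *)
Lemma moment_curl (l i j : 'I_3) :
  (forall y, dot (F y) (curl (W l) y) =
     c * (partial i k (x + (- c) *: y) * coordinate j (F y)
          - partial j k (x + (- c) *: y) * coordinate i (F y))) ->
  c * (kernel_moment F x i j - kernel_moment F x j i) =
  \int[leb3]_y (k (x + (- c) *: y) * ((coordinate l \o curlF) \_ A) y).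
Proof.
move=> FW; have [M [ck kM dk cpk pkM]] := Ck.
have I i' j' : leb3.-integrable setT (EFin \o (fun y =>
    partial i' k (x + (- c) *: y) * ((coordinate j' \o F) \_ A) y)).
  apply: (integrable_boundedM _ _ M) => //; last exact: L2_field_integrable.
  exact: continuous_comp_affine.
rewrite /kernel_moment -RintegralB//.
rewrite -RintegralZl//; last exact: (integrableB measurableT (I i j) (I j i)).
have E := zero_trace_W l; rewrite [LHS]Rintegral_mkcond [RHS]Rintegral_mkcond in E.
(* Off A the restricted functions take the value [point], which is 0 in R; both integrands vanish
   there. *)
have Z1 (u : R) : point = u * point by rewrite mulr0.
have Z (u v a : R) : a * (u * point - v * point) = point by rewrite -!Z1 subrr mulr0.
transitivity (\int[leb3]_y ((fun y => dot (F y) (curl (W l) y)) \_ A) y).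
  apply: eq_Rintegral => y _; rewrite !patchE; case: ifP => _.
    by rewrite FW.
  exact: Z.
rewrite E; apply: eq_Rintegral => y _; rewrite !patchE; case: ifP => _; last exact: Z1.
rewrite dotE /W /unit_vec /coordinate.
case: l {E FW} => -[|[|[|//]]] p /=; rewrite -?[_ *: _]/(_ * _) /w; ring.
Qed.

Lemma curl_smoothing :
  c *: curl (smoothing A chi delta F) x = smoothing A chi delta curlF x.
Proof.
pose m i j := c ^+ 3 * kernel_moment F x i j.
pose Q i j := partial i (coordinate j \o smoothing A chi delta F) x.
have D i j : Q i j = m i j.
  by have [_ d] := is_derive_smoothing F i j x F2; exact: d.
have -> : curl (smoothing A chi delta F) x =
  (Q 1 2 - Q 2 1, Q 2 0 - Q 0 2, Q 0 1 - Q 1 0) by [].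
(* [P i j] is the partial of the j-th component of W in direction i, written out through the
   kernel. *)
have E l y (P := fun i j => (j == l)%:R * (- c * partial i k (x + (- c) *: y))) :
    dot (F y) (curl (W l) y) = coordinate 0 (F y) * (P 1 2 - P 2 1) +
      coordinate 1 (F y) * (P 2 0 - P 0 2) + coordinate 2 (F y) * (P 0 1 - P 1 0).
  pose T i j := partial i (coordinate j \o W l) y.
  have PT i j : P i j = T i j by rewrite /T partial_W.
  have -> : dot (F y) (curl (W l) y) = coordinate 0 (F y) * (T 1 2 - T 2 1) +
      coordinate 1 (F y) * (T 2 0 - T 0 2) + coordinate 2 (F y) * (T 0 1 - T 1 0).
    by rewrite dotE.
  by clearbody P T; rewrite !PT.
(* The cyclic identity is required for arbitrary scalars b, a, u, so that [ring] can decide it; it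
   is then used with b = c, a the components of F and u the partials of k. *)
have K (l i j : 'I_3) : (forall (b : R) (a u : 'I_3 -> R)
      (P := fun i j => (j == l)%:R * (- b * u i)),
      a 0 * (P 1 2 - P 2 1) + a 1 * (P 2 0 - P 0 2) + a 2 * (P 0 1 - P 1 0) =
      b * (u i * a j - u j * a i)) ->
    coordinate l (smoothing A chi delta curlF x) =
    c * (m i j - m j i).
  move=> H; rewrite /m smoothingE// -(moment_curl l i j); last first.
    by move=> y; rewrite E; exact: (H c (fun j => coordinate j (F y))
      (fun i => partial i k (x + (- c) *: y))).
  move: (kernel_moment _ _ _ _) (kernel_moment _ _ _ _) c => u v b; ring.
have K0 := K 0 1 2 ltac:(by move=> b a u P; rewrite /P /=; ring).
have K1 := K 1 2 0 ltac:(by move=> b a u P; rewrite /P /=; ring).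
have K2 := K 2 0 1 ltac:(by move=> b a u P; rewrite /P /=; ring).
clearbody Q m; rewrite !D.
move: K0 K1 K2; rewrite !coordinate3.
by case: (smoothing A chi delta curlF x) => -[a1 a2] a3 /= -> -> ->.
Qed.

End Commutation.
End Smoothing.

(** The partial derivative operator is total, so derivability is asserted alongside the identity to
    make the curl on the left a genuine one. The weak curl of F enters through an arbitrary L^2
    representative [curlF]. *)
Theorem lemma3p6 (R : realType) (Omega : set (R3 R)) (chi : R)
  (Omega_bounded : bounded_set Omega)
  (Omega_open : open Omega)
  (Omega_connected : connected Omega)
  (Omega_lipschitz : lipschitz_boundary Omega)
  (boundary_connected : connected (boundary Omega))
  (Omega0 : Omega 0)
  (Omega_star : exists2 U : set (R3 R), open U /\ U 0 &
     forall z, U z -> star_shaped_at Omega z)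
  (chi_gt0 : 0 < chi)
  (chi_shrink : forall d : R, 0 < d < 1 ->
     compactly_contained
       (minkowski_sum [set (1 - d) *: x | x in Omega] (eball 0 (d * chi)))
       Omega)
  (delta : R) (delta_range : 0 < delta < 2^-1)
  (F : R3 R -> R3 R) (HF : H0curl Omega F)
  (curlF : R3 R -> R3 R)
  (curlF_L2 : L2_field Omega curlF) (curlFE : weak_curl Omega F curlF) :
  forall x : R3 R,
    (forall i, derivable (smoothing Omega chi delta F) x (unit_vec i)) /\
    (1 - delta) *: curl (smoothing Omega chi delta F) x =
      smoothing Omega chi delta curlF x.
Proof.
move=> x; have [delta0 delta_lt] := andP delta_range.
have delta1 : delta < 1 by rewrite (lt_trans delta_lt)// invf_lt1 ?ltr1n.
have mO := open_measurable_R3 _ Omega_open.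
have Ooo := leb3_bounded Omega mO Omega_bounded.
have [F2 _ F0] := HF.
split; last exact: curl_smoothing.
move=> i; apply: derivable_coordinates => j.
by have [] := is_derive_smoothing Omega mO Ooo chi delta delta1 F i j x F2.
Qed.
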